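(* Let $\dim V=(n|m)$ and $h\ge0$ an integer. The element $$\sum_L(-1)^{\alpha(L,L)}\,e_s\big(v_{I_h}\otimes v_L\big)\otimes\tilde e_t\big(v^*_L\otimes v^*_{J_h}\big)\in V^{\otimes n(m+h)}\otimes V^{*\otimes m(n+h)}=T^{n(m+h),m(n+h)}(V),$$ where $L$ runs over all sequences of length $nm$ with entries in $R_V$, is $\mathfrak{sl}(V)$-invariant. (This is the element $e_s\times\tilde e_t(v_{I_h}\otimes\theta_{nm}\otimes v^*_{J_h})$.)
   Context: $V$ has homogeneous basis $e_i$, $i\in R_V=\{1,\dots,n,\bar1,\dots,\bar m\}$ (barred indices odd), $e_i^*$ the left dual basis; $v_I=e_{i_1}\otimes\dots\otimes e_{i_N}$, $v^*_I=e^*_{i_1}\otimes\dots\otimes e^*_{i_N}$; $\alpha(L,L)=\sum_{i<j}p(l_i)p(l_j)$. $\mathfrak S_N$ acts on $X^{\otimes N}$ ($X=V,V^*$) by $\sigma v_I=c(I,\sigma^{-1})v_{\sigma I}$, with $c(I,\sigma)=\pm1$ defined by $x_{\sigma^{-1}I}=c(I,\sigma)x_I$ in the free supercommutative algebra on generators $x_i$ of parity $p(i)$. $e_t=\sum_{\tau\in C_t,\sigma\in R_t}\varepsilon(\tau)\sigma\tau$, $\tilde e_t=\sum_{\tau\in C_t,\sigma\in R_t}\varepsilon(\tau)\tau\sigma$. $t$: rectangular tableau with $n+h$ rows and $m$ columns, first $n$ rows filled with $1,\dots,nm$ column by column, last $h$ rows with $nm+1,\dots,nm+hm$ column by column. $s$: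 tableau with $n$ rows and $h+m$ columns, first $h$ columns filled with $1,\dots,hn$ column by column, last $m$ columns with $hn+1,\dots,hn+mn$ column by column. $I_h$: the sequence $1,\dots,n$ repeated $h$ times; $J_h$: $h$ copies of $\bar1$, then $h$ copies of $\bar2$, ..., $h$ copies of $\bar m$. $e_s$ acts on the $V$-factors, $\tilde e_t$ on the $V^*$-factors. *)

(* Defs.v *)
From HB Require Import structures.
From mathcomp Require Import all_boot all_order all_algebra all_fingroup.
Set Implicit Arguments. Unset Strict Implicit. Unset Printing Implicit Defensive.
Import GRing.Theory.
Local Open Scope ring_scope.

(* Super vector space V of dimension (n|m) over F, homogeneous basis indexed by
   R_V = 'I_(n+m): indices 0..n-1 are the even indices 1..n, indices
   n..n+m-1 are the odd indices 1bar..mbar. *)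
Definition par (n m : nat) (i : 'I_(n+m)) : bool := (n <= i)%N.

Notation mi n m N := {ffun 'I_N -> 'I_(n+m)}.
(* X^{(x) N} (X = V or Vdual) in coordinates: coefficient of v_I (resp. vdual_I) *)
Notation tens F n m N := {ffun mi n m N -> F^o}.
Definition basis (F : fieldType) n m N (I : mi n m N) : tens F n m N :=
  [ffun J => (J == I)%:R].

Definition pact n m N (s : 'S_N) (I : mi n m N) : mi n m N :=
  [ffun k => I ((s^-1)%g k)].

(* c(I,sigma): x_{sigma^{-1} I} = c(I,sigma) x_I in the free supercommutative
   algebra; x_{sigma^{-1} I} = x_{i_sigma(1)} ... x_{i_sigma(N)}, and reordering
   gives the sign (-1)^(number of inversions of sigma between odd entries). *)
Definition csign (F : fieldType) n m N (I : mi n m N) (s : 'S_N) : F :=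
  (-1) ^+ #|[set ab : 'I_N * 'I_N |
      [&& (ab.1 < ab.2)%N, (s ab.2 < s ab.1)%N,
          par (I (s ab.1)) & par (I (s ab.2))]]|.

Definition permact (F : fieldType) n m N (s : 'S_N) (x : tens F n m N)
  : tens F n m N :=
  \sum_(I : mi n m N) (x I * csign F I (s^-1)%g) *: basis F (pact s I).

(* Row and column groups of a tableau given by row/column position functions
   (positions 0..N-1 stand for the entries 1..N). *)
Definition Rgrp N (row : nat -> nat) : {set 'S_N} :=
  [set s : 'S_N | [forall k : 'I_N, row (s k) == row k]].

Definition sgnF (F : fieldType) N (t : 'S_N) : F := (-1) ^+ odd_perm t.

Definition ysym (F : fieldType) n m N (row col : nat -> nat) (x : tens F n m N)
  : tens F n m N :=
  \sum_(tau in Rgrp N col) \sum_(sg in Rgrp N row)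
     sgnF F tau *: permact sg (permact tau x).

Definition ysymt (F : fieldType) n m N (row col : nat -> nat) (x : tens F n m N)
  : tens F n m N :=
  \sum_(tau in Rgrp N col) \sum_(sg in Rgrp N row)
     sgnF F tau *: permact tau (permact sg x).

(* Tableau s : n rows, h+m columns, filled column by column with 1..n(h+m)
   (first h columns with 1..hn, then last m columns with hn+1..hn+mn). *)
Definition s_row (n : nat) (k : nat) : nat := (k %% n)%N.
Definition s_col (n : nat) (k : nat) : nat := (k %/ n)%N.

(* Tableau t : n+h rows, m columns; first n rows filled column by column with
   1..nm, last h rows filled column by column with nm+1..nm+hm. *)
Definition t_row (n m h : nat) (k : nat) : nat :=
  (if k < n * m then k %% n else n + (k - n * m) %% h)%N.
Definition t_col (n m h : nat) (k : nat) : nat :=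
  (if k < n * m then k %/ n else (k - n * m) %/ h)%N.

Definition catmi n m p q (a : mi n m p) (b : mi n m q) : mi n m (p + q) :=
  [ffun k => match split k with inl i => a i | inr j => b j end].

Lemma Ih_lt n m h k : (k < n * h)%N -> (k %% n < n + m)%N.
Proof.
case: n => [|n]; first by rewrite mul0n.
by move=> _; apply: leq_trans (ltn_pmod _ _) (leq_addr _ _).
Qed.

Lemma Jh_lt n m h k : (k < h * m)%N -> (n + k %/ h < n + m)%N.
Proof.
case: h => [|h]; first by rewrite mul0n.
by move=> Hk; rewrite ltn_add2l ltn_divLR // mulnC.
Qed.

(* I_h = 1,...,n repeated h times *)
Definition Ih n m h : mi n m (n * h) := [ffun k => Ordinal (Ih_lt m (ltn_ord k))].
(* J_h = h copies of 1bar, then h copies of 2bar, ..., h copies of mbar *)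
Definition Jh n m h : mi n m (h * m) := [ffun k => Ordinal (Jh_lt n (ltn_ord k))].

Definition alpha n m N (L : mi n m N) : nat :=
  (\sum_(i < N) \sum_(j < N | (i < j)%N) par (L i) * par (L j))%N.

(* mixed tensors T^{p,q}(V) = V^{(x)p} (x) Vdual^{(x)q}: coefficient of v_I (x) vdual_K *)
Notation mtens F n m p q := {ffun mi n m p * mi n m q -> F^o}.
Definition mbasis (F : fieldType) n m p q (I : mi n m p) (K : mi n m q)
  : mtens F n m p q := [ffun JK => ((JK.1 == I) && (JK.2 == K))%:R].
Definition tprod (F : fieldType) n m p q (x : tens F n m p) (y : tens F n m q)
  : mtens F n m p q := [ffun JK => x JK.1 * y JK.2].

Definition upd n m N (I : mi n m N) (a : 'I_N) (r : 'I_(n+m)) : mi n m N :=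
  [ffun k => if k == a then r else I k].

(* Action of a homogeneous X in gl(V) of parity b (X e_j = sum_i X_ij e_i,
   X edual_j = -(-1)^{b p(j)} sum_k X_jk edual_k) on the basis tensor
   e_{i_1}..e_{i_p} edual_{k_1}..edual_{k_q}, via the super Leibniz rule. *)
Definition actb (F : fieldType) n m (b : bool) (X : 'M[F]_(n+m)) p q
  (I : mi n m p) (K : mi n m q) : mtens F n m p q :=
  \sum_(a < p) \sum_(r : 'I_(n+m))
     ((-1) ^+ (b * (\sum_(a' < p | (a' < a)%N) par (I a')))%N * X r (I a))
       *: mbasis F (upd I a r) K
  + \sum_(c < q) \sum_(r : 'I_(n+m))
     ((-1) ^+ (b * ((\sum_(a < p) par (I a))
                     + \sum_(c' < q | (c' < c)%N) par (K c')))%N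
      * (- ((-1) ^+ (b * par (K c))%N * X (K c) r)))
       *: mbasis F I (upd K c r).

Definition mact (F : fieldType) n m (b : bool) (X : 'M[F]_(n+m)) p q
  (w : mtens F n m p q) : mtens F n m p q :=
  \sum_(IK : mi n m p * mi n m q) w IK *: actb b X IK.1 IK.2.

Definition homogeneous (F : fieldType) n m (b : bool) (X : 'M[F]_(n+m)) : Prop :=
  forall i j, addb (par i) (par j) != b -> X i j = 0.

Definition str (F : fieldType) n m (X : 'M[F]_(n+m)) : F :=
  \sum_(i : 'I_(n+m)) (-1) ^+ par i * X i i.

Definition sl_invariant (F : fieldType) n m p q (w : mtens F n m p q) : Prop :=
  forall (b : bool) (X : 'M[F]_(n+m)),
    homogeneous b X -> str X = 0 -> mact b X w = 0.

(* Main.v *)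
(** Write [D X] for the super-derivation of a tensor power given by [X]; it
    commutes with the signed action of the symmetric group, and the canonical
    tensor [\sum_L (-1)^alpha(L) v_L (x) v*_L] is invariant. Hence [X] acts on the
    element [w] only through [v_Ih] and [v*_Jh] (lemma [mact_invelt]).

    - If [X] is even, a repeated even label in a column of [s], or a repeated
      odd label in a row of [t], kills the off-diagonal contributions, and
      [X w = h str(X) w].
    - If [X] sends odd vectors to even ones (is raising), [X w = 0] at once.
    - If [X] sends even vectors to odd ones, put [w' = X w]. Every raising [Y]
      kills [w'], because [[Y, X]] is even of supertrace 0. As a tensor in the
      [V]-factors, [w'] is symmetric along the [n] rows of [s], i.e. it lies in
      Sym(V (x) F^n) = F[x_ia] (x) Lambda[xi_ja], where the raising operators are
      [\sum_a x_ia d/dxi_ja]. As the matrix [(x_ia)] is generically invertible, a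
      vector killed by all of them involves no [xi]. The component of [w']
      without odd entries in the [V]-factors vanishes by counting the even
      entries in the columns of [t], so [w' = 0]. *)

Require Import Defs.
From HB Require Import structures.
From mathcomp Require Import all_boot all_order all_algebra all_fingroup ring zify.
Set Implicit Arguments. Unset Strict Implicit. Unset Printing Implicit Defensive.
Import GRing.Theory.
Local Open Scope ring_scope.

(** * Signs *)

Section Signs.
Variable N : nat.
Implicit Types (p q : 'I_N -> bool) (u s t : 'S_N).

(** Sign exponents are kept as booleans under [addb], so that sign identities reduce to case
    analysis. The predicate [p] marks the odd sites; in [xinv u p] these are the sites before [u] is
    applied. *)
Definition xpre p (c : 'I_N) : bool := \big[addb/false]_(a < N) ((a < c)%N && p a).
Definition xtot p : bool := \big[addb/false]_(a < N) p a.
Definition xinv u p : bool :=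
  \big[addb/false]_(a < N) \big[addb/false]_(b < N)
     [&& (a < b)%N, (u b < u a)%N, p a & p b].

Lemma eq_xpre p q c : p =1 q -> xpre p c = xpre q c.
Proof. by move=> e; apply: eq_bigr => a _; rewrite e. Qed.

Lemma eq_xtot p q : p =1 q -> xtot p = xtot q.
Proof. by move=> e; apply: eq_bigr => a _; rewrite e. Qed.

Lemma eq_xinv u p q : p =1 q -> xinv u p = xinv u q.
Proof. by move=> e; apply: eq_bigr => a _; apply: eq_bigr => b _; rewrite !e. Qed.

Lemma xtot_perm s p : xtot (fun a => p (s a)) = xtot p.
Proof. by rewrite /xtot [RHS](reindex_inj (@perm_inj _ s)). Qed.

Lemma big_addb_delta (c : 'I_N) (X : bool) :
  \big[addb/false]_(b < N) ((b == c) && X) = X.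
Proof.
by rewrite (bigD1 c) //= eqxx big1 ?addbF // => b /negPf ->.
Qed.

Lemma xtot_upd p q c :
  (forall a, a != c -> q a = p a) -> xtot q = xtot p (+) p c (+) q c.
Proof.
move=> e; rewrite /xtot (bigD1 c) //= [in RHS](bigD1 c) //=.
by rewrite (eq_bigr _ e); do 2!case: (_ c); case: (\big[_/_]_(_ < _ | _) _).
Qed.

Lemma xpre_upd p q c d :
  (forall a, a != c -> q a = p a) ->
  xpre q d = xpre p d (+) ((c < d)%N && (p c (+) q c)).
Proof.
move=> e; rewrite /xpre (bigD1 c) //= [in RHS](bigD1 c) //=.
rewrite (eq_bigr (fun a : 'I_N => (a < d)%N && p a)); last by move=> a /e ->.
by case: (c < d)%N; do 2!case: (_ c); case: (\big[_/_]_(_ < _ | _) _).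
Qed.

(** A site [a] is inverted with [c] exactly when one, but not both, of [a < c] and [u a < u c]
    holds. Counted modulo 2 over the odd sites, this gives the sum of the two prefix parities. *)
Lemma xinv_toggle u p q c :
  (forall a, a != c -> q a = p a) -> q c = ~~ p c ->
  xinv u q = xinv u p (+) xpre p c (+) xpre (fun a => p ((u^-1)%g a)) (u c).
Proof.
move=> e ec.
suff: xinv u q (+) xinv u p = xpre p c (+) xpre (fun a => p ((u^-1)%g a)) (u c).
  by rewrite -addbA => <-; case: (xinv u q); case: (xinv u p).
have qE a : q a = p a (+) (a == c).
  by case: eqP => [->|/eqP/e ->]; rewrite ?ec ?addbT ?addbF.
rewrite [xpre _ (u c)](reindex_inj (@perm_inj _ u)) /=.
under eq_bigr => a _ do rewrite permK.
rewrite /xinv /xpre -!big_split /=.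
under eq_bigr => a _ do rewrite -big_split /=.
under eq_bigr => a _.
  under eq_bigr => b _.
    (* Only pairs containing [c] change; they are sorted by whether [c] is the second or the first
       member. *)
    have -> : [&& (a < b)%N, (u b < u a)%N, q a & q b]
       (+) [&& (a < b)%N, (u b < u a)%N, p a & p b] =
       ((b == c) && [&& (a < c)%N, (u c < u a)%N & p a])
        (+) ((a == c) && [&& (c < b)%N, (u b < u c)%N & p b]).
      rewrite !qE; case: (eqVneq b c) => [->|_]; case: (eqVneq a c) => [->|_];
        rewrite ?ltnn ?addbF ?addbT //=.
      - by case: (a < c)%N; case: (u c < u a)%N; case: (p a); case: (p c).
      - by case: (c < b)%N; case: (u b < u c)%N; case: (p b); case: (p c).
      by rewrite addbb.
    over.
  rewrite big_split /= big_addb_delta.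
  over.
rewrite big_split /=.
rewrite (exchange_big_dep predT) //=.
under [X in _ (+) X]eq_bigr => b _ do rewrite big_addb_delta.
rewrite -big_split /=; apply: eq_bigr => a _.
case: (eqVneq a c) => [->|nac]; first by rewrite !ltnn.
have nu : u a != u c by rewrite (inj_eq perm_inj).
move: nac nu; rewrite -!val_eqE /=; case: ltngtP => // _ _; case: ltngtP => // _ _;
by case: (p a).
Qed.

Lemma xinv0 u p : p =1 xpred0 -> xinv u p = false.
Proof.
move=> e; rewrite /xinv big1 // => a _; rewrite big1 // => b _.
by rewrite e !andbF.
Qed.

Lemma pred_ind_toggle (P : ('I_N -> bool) -> Prop) :
  (forall p, p =1 xpred0 -> P p) ->
  (forall p c, p c -> P (fun a => p a && (a != c)) -> P p) ->
  forall p, P p.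
Proof.
move=> P0 PS p; move: {2}(#|p|) (leqnn #|p|) => k; elim: k p => [|k IH] p le_k.
  by apply: P0 => a; apply: (card0_eq (A := p)); apply/eqP; rewrite -leqn0.
case: (pickP p) => [c pc|p0]; last by apply: P0.
apply: (PS p c pc); apply: IH; rewrite -ltnS (leq_trans _ le_k) //.
apply: proper_card; apply/properP; split.
  by apply/subsetP => a; rewrite !unfold_in => /andP[].
by exists c; rewrite !unfold_in // eqxx andbF.
Qed.

(** The cocycle rule that makes [permact] an action. Both sides vanish when no site is odd, and they
    change equally when one odd site is removed: the prefix parity at the intermediate site [s^-1 c]
    occurs twice and cancels. *)
Lemma xinvM s t p :
  xinv (t * s)^-1%g p = xinv s^-1%g p (+) xinv t^-1%g (fun a => p (s a)).
Proof.
elim/pred_ind_toggle: p => [p p0|p c pc IH].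
  by rewrite !xinv0 // => a; rewrite p0.
set r := (fun a => p a && (a != c)) in IH.
have e a : a != c -> p a = r a by rewrite /r => ->; rewrite andbT.
have ec : p c = ~~ r c by rewrite /r eqxx andbF pc.
rewrite (xinv_toggle (t * s)^-1%g e ec) (xinv_toggle s^-1%g e ec).
have e' a : a != s^-1%g c -> p (s a) = r (s a).
  by move=> na; apply: e; apply: contraNneq na => <-; rewrite permK.
have ec' : p (s (s^-1%g c)) = ~~ r (s (s^-1%g c)) by rewrite permKV.
rewrite (xinv_toggle t^-1%g (p := fun a => r (s a)) e' ec') IH !invgK.
rewrite invMg permM.
rewrite [xpre (fun a => r ((t * s)%g a)) _](@eq_xpre _ (fun a => r (s (t a)))); last first.
  by move=> a; rewrite permM.
move: (xpre _ _) (xpre _ (s^-1%g c)) (xpre r c) (xinv t^-1%g _) (xinv s^-1%g r).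
by do 5!case.
Qed.

(** If both sites are odd, each odd site between them is inverted with both, so modulo 2 only the
    pair itself counts. If both are even, every odd site stays in place. *)
Lemma xinv_tperm k l p :
  k != l -> p k = p l -> xinv (tperm k l)^-1%g p = p k.
Proof.
move=> nkl.
have base q : ~~ q k -> ~~ q l -> xinv (tperm k l) q = false.
  move=> qk ql; rewrite /xinv big1 // => a _; rewrite big1 // => b _.
  case: tpermP => [->|->|_ _]; rewrite ?(negPf qk) ?(negPf ql) ?andbF //.
  case: tpermP => [->|->|_ _]; rewrite ?(negPf qk) ?(negPf ql) ?andbF //.
  by case: ltngtP.
rewrite tpermV; case pk: (p k) => pl; last by rewrite base ?pk -?pl.
pose r := (fun a => p a && (a != k)).
pose o := (fun a => r a && (a != l)).
have e1 a : a != k -> p a = r a by rewrite /r => ->; rewrite andbT.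
have e2 a : a != l -> r a = o a by rewrite /o => ->; rewrite andbT.
rewrite (xinv_toggle (tperm k l) e1) ?/r ?eqxx ?andbF ?pk // -/r.
rewrite (xinv_toggle (tperm k l) e2) ?/o ?/r ?eqxx ?andbF -?pl ?(eq_sym l k) ?nkl // -/r -/o.
have ok : o k = false by rewrite /o /r eqxx andbF.
have ol : o l = false by rewrite /o eqxx andbF.
rewrite base ?ok ?ol // tpermL tpermR tpermV addFb.
have oE : (fun a => o (tperm k l a)) =1 o.
  by move=> a; case: tpermP => [->|->|//]; rewrite ok ol.
rewrite (eq_xpre k oE).
have rl : r l by rewrite /r eq_sym nkl -pl.
have rk : r k = false by rewrite /r eqxx andbF.
rewrite (xpre_upd (p := o) (q := r) k e2) ol rl.
rewrite (xpre_upd (p := o) (q := fun a => r (tperm k l a)) (c := k) l).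
  rewrite tpermL ok rl !andbT.
  by move: nkl; rewrite -val_eqE; case: ltngtP => //; do 2!case: (xpre o _).
move=> a nak; case: tpermP => [ea|->|_ nal]; first by rewrite ea eqxx in nak.
  by rewrite rk ol.
by apply: e2; apply/eqP.
Qed.

End Signs.

Section SignsF.
Variable F : fieldType.

Lemma signr_sum N (P : pred 'I_N) (f : 'I_N -> bool) :
  (-1) ^+ (\sum_(a < N | P a) f a)%N = (-1) ^+ (\big[addb/false]_(a < N) (P a && f a)) :> F.
Proof.
rewrite -signr_odd (big_morph odd oddD (erefl _)) /= big_mkcond /=.
by congr (_ ^+ nat_of_bool _); apply: eq_bigr => a _; rewrite oddb; case: (P a).
Qed.

Lemma csignE n m N (I : mi n m N) (s : 'S_N) :
  csign F I s = (-1) ^+ xinv s (fun a => par (I (s a))).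
Proof.
rewrite /csign -sum1dep_card -signr_odd (big_morph odd oddD (erefl _)) /=.
rewrite /xinv pair_bigA /= big_mkcond /=.
by congr (_ ^+ nat_of_bool _); apply: eq_bigr => a _; case: ifP.
Qed.

End SignsF.

(** * Super-derivations of tensor powers *)

Section MultiIndices.
Variables n m N : nat.
Implicit Types (I J L : mi n m N) (a c : 'I_N) (i j r : 'I_(n + m)) (s t : 'S_N).

Definition oddsite I : 'I_N -> bool := fun a => par (I a).

Lemma upd_id I a : upd I a (I a) = I.
Proof. by apply/ffunP => k; rewrite ffunE; case: eqP => [->|]. Qed.

Lemma upd_at I a r : upd I a r a = r.
Proof. by rewrite ffunE eqxx. Qed.

Lemma upd_ne I a r c : c != a -> upd I a r c = I c.
Proof. by rewrite ffunE => /negPf ->. Qed.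

Lemma upd_upd I a i j : upd (upd I a i) a j = upd I a j.
Proof. by apply/ffunP => k; rewrite !ffunE; case: eqP. Qed.

Lemma updC I a c i j : a != c -> upd (upd I a i) c j = upd (upd I c j) a i.
Proof.
by move=> nac; apply/ffunP => k; rewrite !ffunE; case: eqP => // ->; rewrite eq_sym (negPf nac).
Qed.

Lemma oddsite_upd_ne I a r c : c != a -> oddsite (upd I a r) c = oddsite I c.
Proof. by move=> nca; rewrite /oddsite upd_ne. Qed.

Lemma oddsite_upd_at I a r : oddsite (upd I a r) a = par r.
Proof. by rewrite /oddsite upd_at. Qed.

Lemma xpre_oddsite_upd I a r c :
  xpre (oddsite (upd I a r)) c = xpre (oddsite I) c (+) ((a < c)%N && (par (I a) (+) par r)).
Proof.
rewrite (xpre_upd (p := oddsite I) (c := a)) ?oddsite_upd_at // => d.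
exact: oddsite_upd_ne.
Qed.

Lemma xtot_oddsite_upd I a r :
  xtot (oddsite (upd I a r)) = xtot (oddsite I) (+) par (I a) (+) par r.
Proof.
rewrite (xtot_upd (p := oddsite I) (c := a)) ?oddsite_upd_at // => d.
exact: oddsite_upd_ne.
Qed.

Lemma pactE s J a : pact s^-1%g J a = J (s a).
Proof. by rewrite ffunE invgK. Qed.

Lemma pactK s : cancel (pact (n := n) (m := m) s) (pact s^-1%g).
Proof. by move=> J; apply/ffunP => k; rewrite !ffunE invgK permK. Qed.

Lemma pactKV s : cancel (pact (n := n) (m := m) s^-1%g) (pact s).
Proof. by move=> J; apply/ffunP => k; rewrite !ffunE invgK permKV. Qed.

Lemma pactM s t J : pact (t * s)^-1%g J = pact t^-1%g (pact s^-1%g J).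
Proof. by apply/ffunP => k; rewrite !ffunE !invgK permM. Qed.

Lemma upd_pact s J a i : upd (pact s^-1%g J) a i = pact s^-1%g (upd J (s a) i).
Proof. by apply/ffunP => k; rewrite !ffunE !invgK (inj_eq perm_inj). Qed.

Lemma oddsite_pact s J : oddsite (pact s^-1%g J) =1 (fun a => oddsite J (s a)).
Proof. by move=> a; rewrite /oddsite pactE. Qed.

(** Exchanging the summed label with the label at site [a] is an involution. This passes between
    indexing a one-site operator by its input and by its output. *)
Lemma sum_upd_swap (V : nmodType) a (G : mi n m N -> 'I_(n + m) -> V) :
  \sum_I \sum_r G I r = \sum_I \sum_r G (upd I a r) (I a).
Proof.
rewrite !pair_bigA /=.
rewrite (reindex_inj (h := fun Ir => (upd Ir.1 a Ir.2, Ir.1 a))) //=.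
apply: (can_inj (g := fun Ir => (upd Ir.1 a Ir.2, Ir.1 a))) => -[I r] /=.
by rewrite upd_upd upd_id upd_at.
Qed.

End MultiIndices.

(** * Signed permutations and super-derivations in coordinates *)

Section Tensors.
Variables (F : fieldType) (n m : nat).

Section OneFactor.
Variable N : nat.
Implicit Types (x y : tens F n m N) (I J L : mi n m N) (a c : 'I_N).
Implicit Types (s t : 'S_N) (A B : 'M[F]_(n + m)).

Lemma permactE s x J :
  permact s x J = (-1) ^+ xinv s^-1%g (oddsite J) * x (pact s^-1%g J).
Proof.
rewrite /permact sum_ffunE (bigD1 (pact s^-1%g J)) //= big1 => [|I neI].
  rewrite !ffunE addr0 pactKV eqxx /= csignE mulrC.
  rewrite (@eq_xinv _ _ _ (oddsite J)); last by move=> a; rewrite pactE permKV.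
  by rewrite -[LHS]mulrA [_ * _%:R]mulr1 mulrC.
rewrite !ffunE; case: eqP => [eJ|]; last by rewrite /GRing.scale /= mulr0.
by rewrite eJ pactK eqxx in neI.
Qed.

Lemma permact_is_linear s : linear (@permact F n m N s).
Proof.
move=> k x y; apply/ffunP => J; rewrite !(permactE, ffunE) /GRing.scale /=.
by rewrite mulrDr mulrCA.
Qed.
HB.instance Definition _ s :=
  GRing.isLinear.Build F (tens F n m N) (tens F n m N) _ (@permact F n m N s)
    (permact_is_linear s).

Lemma permactM s t x : permact s (permact t x) = permact (t * s)%g x.
Proof.
apply/ffunP => J; rewrite !permactE pactM mulrA -signr_addb xinvM.
by congr ((-1) ^+ nat_of_bool (_ (+) _) * _); apply: eq_xinv => a; rewrite oddsite_pact.
Qed.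

(** [A], of parity [b], applied to the factor [a]. The Koszul sign is read off the output index [J],
    which agrees with the input index on all factors before [a]. *)
Definition dsite (b : bool) A a x : tens F n m N :=
  [ffun J => \sum_i (-1) ^+ (b && xpre (oddsite J) a) * A (J a) i * x (upd J a i)].

Lemma dsiteE b A a x J : dsite b A a x J =
  \sum_i (-1) ^+ (b && xpre (oddsite J) a) * A (J a) i * x (upd J a i).
Proof. by rewrite ffunE. Qed.

Lemma dsite_is_linear b A a : linear (dsite b A a).
Proof.
move=> k x y; apply/ffunP => J; rewrite !ffunE /GRing.scale /= mulr_sumr -big_split /=.
by apply: eq_bigr => i _; rewrite !ffunE /GRing.scale /= mulrDr mulrCA.
Qed.
HB.instance Definition _ b A a :=
  GRing.isLinear.Build F (tens F n m N) (tens F n m N) _ (dsite b A a)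
    (dsite_is_linear b A a).

(** For odd [A], the surviving terms flip the parity at one site, and [xinv_toggle] accounts for the
    difference of the two prefix signs. For even [A], the pattern of odd sites does not change. *)
Lemma permact_dsite b A a s x : homogeneous b A ->
  permact s (dsite b A a x) = dsite b A (s a) (permact s x).
Proof.
move=> hA; apply/ffunP => J; rewrite permactE !dsiteE mulr_sumr.
apply: eq_bigr => i _; rewrite pactE.
have [e|/hA ->] := eqVneq (par (J (s a)) (+) par i) b; last by rewrite !(mulr0, mul0r).
rewrite permactE upd_pact !mulrA; congr (_ * _).
rewrite [RHS]mulrAC; congr (_ * _); rewrite -!signr_addb.
congr (_ ^+ nat_of_bool _).
rewrite (eq_xpre a (oddsite_pact s J)).
move: e; case: b {hA} => /= [e|/eqP].
  rewrite (xinv_toggle s^-1%g (p := oddsite J) (q := oddsite (upd J (s a) i)) (c := s a)).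
  - rewrite invgK permK; case: (xpre _ (s a)); case: (xinv _ _); by case: (xpre _ _).
  - by move=> d; apply: oddsite_upd_ne.
  by rewrite oddsite_upd_at /oddsite; move: e; do 2!case: (par _).
rewrite eqbF_neg -negb_eqb negbK addbF => /eqP e.
apply: eq_xinv => c.
by case: (eqVneq c (s a)) => [->|nc]; rewrite ?oddsite_upd_at ?oddsite_upd_ne // /oddsite e.
Qed.

Definition dop b A x : tens F n m N := \sum_(a < N) dsite b A a x.

Lemma dopE b A x J : dop b A x J =
  \sum_(a < N) \sum_i (-1) ^+ (b && xpre (oddsite J) a) * A (J a) i * x (upd J a i).
Proof. by rewrite sum_ffunE; apply: eq_bigr => a _; rewrite ffunE. Qed.

Lemma dop_is_linear b A : linear (dop b A).
Proof.
move=> k x y; rewrite /dop scaler_sumr -big_split /=.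
by apply: eq_bigr => a _; rewrite linearP.
Qed.
HB.instance Definition _ b A :=
  GRing.isLinear.Build F (tens F n m N) (tens F n m N) _ (dop b A)
    (dop_is_linear b A).

Lemma permact_dop b A s x : homogeneous b A ->
  permact s (dop b A x) = dop b A (permact s x).
Proof.
move=> hA; rewrite linear_sum /dop (reindex_inj (@perm_inj _ s^-1%g)) /=.
by apply: eq_bigr => a _; rewrite permact_dsite // permKV.
Qed.

Lemma dop_basis b A I :
  dop b A (basis F I) =
  \sum_(a < N) \sum_r ((-1) ^+ (b && xpre (oddsite I) a) * A r (I a))
      *: basis F (upd I a r).
Proof.
apply/ffunP => J; rewrite dopE sum_ffunE; apply: eq_bigr => a _.
rewrite sum_ffunE.
(* The coordinate at [J] is spread into a sum over all [L], so that [sum_upd_swap] applies. *)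
transitivity (\sum_L \sum_i (L == J)%:R *
  ((-1) ^+ (b && xpre (oddsite L) a) * A (L a) i * (upd L a i == I)%:R)).
  rewrite (bigD1 J) //= [X in _ = _ + X]big1 => [|L /negPf neL].
    by rewrite addr0; apply: eq_bigr => i _; rewrite eqxx mul1r ffunE.
  by apply: big1 => i _; rewrite neL mul0r.
rewrite (sum_upd_swap a) (bigD1 I) //= [X in _ + X]big1 => [|L /negPf neL].
  rewrite addr0; apply: eq_bigr => i _; rewrite !ffunE /GRing.scale /=.
  rewrite !eqxx upd_upd upd_id eqxx mulr1 mulrC eq_sym.
  by rewrite xpre_oddsite_upd ltnn addbF.
by apply: big1 => i _; rewrite upd_upd upd_id neL !mulr0.
Qed.

Definition psgn (b : bool) x : tens F n m N :=
  [ffun I => (-1) ^+ (b && xtot (oddsite I)) * x I].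

Lemma psgn_is_linear b : linear (psgn b).
Proof.
by move=> k x y; apply/ffunP => J; rewrite !ffunE /GRing.scale /= mulrDr mulrCA.
Qed.
HB.instance Definition _ b :=
  GRing.isLinear.Build F (tens F n m N) (tens F n m N) _ (psgn b)
    (psgn_is_linear b).

Lemma permact_psgn b s x : permact s (psgn b x) = psgn b (permact s x).
Proof.
apply/ffunP => J; rewrite !(permactE, ffunE) mulrCA.
by rewrite (eq_xtot (oddsite_pact s J)) xtot_perm.
Qed.

Lemma psgn_basis b I :
  psgn b (basis F I) = (-1) ^+ (b && xtot (oddsite I)) *: basis F I.
Proof.
apply/ffunP => J; rewrite !ffunE /GRing.scale /=.
by case: eqP => [->//|_]; rewrite !mulr0.
Qed.

(** The operator at the earlier of the two sites flips the prefix parity seen by the one at the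
    later site, in one of the two orders only. *)
Lemma dsite_anticomm A B a c x : homogeneous true A -> homogeneous true B ->
  a != c -> dsite true A a (dsite true B c x) = - dsite true B c (dsite true A a x).
Proof.
move=> hA hB nac; apply/ffunP => J; rewrite [in RHS]ffunE !dsiteE -sumrN.
under eq_bigr => i _ do rewrite dsiteE mulr_sumr.
rewrite exchange_big /=; apply: eq_bigr => k _; rewrite dsiteE mulr_sumr -sumrN.
apply: eq_bigr => i _.
rewrite (upd_ne J i (_ : c != a)) 1?eq_sym // (upd_ne J k nac) (updC J i k nac).
have [eA|/hA ->] := eqVneq (par (J a) (+) par i) true; last by rewrite !(mulr0, mul0r, oppr0).
have [eB|/hB ->] := eqVneq (par (J c) (+) par k) true; last by rewrite !(mulr0, mul0r, oppr0).
rewrite !xpre_oddsite_upd eA eB !andbT !andTb.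
rewrite !mulrA -[in RHS]mulNr; congr (_ * _).
rewrite [X in X * _ = _]mulrAC [X in _ = - (X * _)]mulrAC -!signr_addb.
rewrite [in RHS]mulrAC -!mulNr; congr (_ * _ * _).
rewrite -signrN; congr (_ ^+ nat_of_bool _).
by move: nac; rewrite -val_eqE; case: ltngtP => //= _ _; do 2!case: (xpre _ _).
Qed.

Lemma dsite_mul A B a x :
  dsite true A a (dsite true B a x) = dsite false (A *m B) a x.
Proof.
apply/ffunP => J; rewrite !dsiteE.
under eq_bigr => i _ do rewrite dsiteE mulr_sumr.
rewrite exchange_big /=; apply: eq_bigr => k _; rewrite mxE mulr_sumr mulr_suml.
apply: eq_bigr => i _.
rewrite upd_at upd_upd xpre_oddsite_upd ltnn addbF mul1r.
by rewrite !mulrA [X in X * _ * _]mulrAC -signr_addb addbb mul1r.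
Qed.

Lemma dop_anticomm A B x : homogeneous true A -> homogeneous true B ->
  dop true A (dop true B x) + dop true B (dop true A x)
  = dop false (A *m B + B *m A) x.
Proof.
move=> hA hB; rewrite {1}/dop [dop true A x]/dop linear_sum /=.
rewrite {2}/dop -big_split /= /dop; apply: eq_bigr => a _.
rewrite linear_sum /= -big_split /= (bigD1 a) //= big1 => [|c nca]; last first.
  by rewrite dsite_anticomm 1?eq_sym // addNr.
rewrite addr0 !dsite_mul; apply/ffunP => J; rewrite ffunE !dsiteE -big_split /=.
by apply: eq_bigr => i _; rewrite [in RHS]mxE mulrDr mulrDl.
Qed.

End OneFactor.
End Tensors.

(** * Mixed tensors *)

Section MixedTensors.
Variables (F : fieldType) (n m : nat).
Implicit Types (b : bool) (X Y : 'M[F]_(n + m)).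

(** The negative supertranspose: column [k] holds the coordinates of [X] applied to the dual basis
    vector of index [k]. *)
Definition dualmx b X : 'M[F]_(n + m) :=
  \matrix_(r, k) (- ((-1) ^+ (b && par k) * X k r)).

Lemma homogeneous_dual b X : homogeneous b X -> homogeneous b (dualmx b X).
Proof.
by move=> hX i j nb; rewrite mxE hX ?mulr0 ?oppr0 // addbC.
Qed.

Lemma dualmxD b X Y : dualmx b (X + Y) = dualmx b X + dualmx b Y.
Proof. by apply/matrixP => i j; rewrite !mxE mulrDr opprD. Qed.

Lemma dualmx_anticomm X Y : homogeneous true X -> homogeneous true Y ->
  dualmx true X *m dualmx true Y + dualmx true Y *m dualmx true X
  = dualmx false (X *m Y + Y *m X).
Proof.
(* Duality reverses products; the two parity signs multiply to -1, which is the minus sign of the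
   even dual matrix. *)
have mulE A B : homogeneous true A -> homogeneous true B ->
    dualmx true A *m dualmx true B = dualmx false (B *m A).
  move=> hA hB; apply/matrixP => i k; rewrite !mxE mul1r -sumrN.
  apply: eq_bigr => l _; rewrite !mxE mulrNN.
  have [e|/hB ->] := eqVneq (par k (+) par l) true; last by rewrite !(mulr0, mul0r, oppr0).
  rewrite mulrACA -signr_addb (addbC (par l)) e expr1 mulN1r mulrC //.
by move=> hX hY; rewrite !mulE // -dualmxD addrC.
Qed.

Lemma fadd_ffunE (T : finType) (x y : {ffun T -> F^o}) i : (x + y) i = x i + y i.
Proof. by rewrite ffunE. Qed.

Lemma fscale_ffunE (T : finType) (k : F) (x : {ffun T -> F^o}) i : (k *: x) i = k * x i.
Proof. by rewrite ffunE. Qed.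

Variables p q : nat.
Implicit Types (I : mi n m p) (K : mi n m q) (w : mtens F n m p q).

Definition lslice K w : tens F n m p := [ffun I => w (I, K)].
Definition rslice I w : tens F n m q := [ffun K => w (I, K)].

Lemma lslice_is_linear K : linear (lslice K).
Proof. by move=> k x y; apply/ffunP => J; rewrite !ffunE. Qed.
HB.instance Definition _ K :=
  GRing.isLinear.Build F (mtens F n m p q) (tens F n m p) _ (lslice K)
    (lslice_is_linear K).

Lemma rslice_is_linear I : linear (rslice I).
Proof. by move=> k x y; apply/ffunP => J; rewrite !ffunE. Qed.
HB.instance Definition _ I :=
  GRing.isLinear.Build F (mtens F n m p q) (tens F n m q) _ (rslice I)
    (rslice_is_linear I).

(** The coordinate form of [mact]: one summand acts along the V-factors, the other along the dual
    factors after crossing all V-factors. Agreement with [mact] is [mact_sact]. *)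
Definition sact b X w : mtens F n m p q :=
  [ffun IK => dop b X (lslice IK.2 w) IK.1
     + (-1) ^+ (b && xtot (oddsite IK.1)) * dop b (dualmx b X) (rslice IK.1 w) IK.2].

Lemma sactE b X w I K : sact b X w (I, K) = dop b X (lslice K w) I
     + (-1) ^+ (b && xtot (oddsite I)) * dop b (dualmx b X) (rslice I w) K.
Proof. by rewrite ffunE. Qed.

Lemma sact_is_linear b X : linear (sact b X).
Proof.
move=> k x y; apply/ffunP => -[I K]; rewrite fadd_ffunE fscale_ffunE !sactE.
rewrite (linearP (lslice K)) (linearP (rslice I)) !linearP /=.
rewrite !(fadd_ffunE, fscale_ffunE) !mulrDr addrACA.
by congr (_ + _ + _); rewrite mulrCA.
Qed.
HB.instance Definition _ b X :=
  GRing.isLinear.Build F (mtens F n m p q) (mtens F n m p q) _ (sact b X)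
    (sact_is_linear b X).

Lemma lslice_tprod K (x : tens F n m p) (y : tens F n m q) :
  lslice K (tprod x y) = y K *: x.
Proof. by apply/ffunP => J; rewrite !ffunE /= mulrC. Qed.

Lemma sact_tprod b X (x : tens F n m p) (y : tens F n m q) :
  sact b X (tprod x y) =
  tprod (dop b X x) y + tprod (psgn b x) (dop b (dualmx b X) y).
Proof.
apply/ffunP => -[I K]; rewrite sactE [RHS]ffunE [tprod (dop _ _ _) _ _]ffunE.
rewrite [tprod (psgn _ _) _ _]ffunE [psgn _ _ _]ffunE /=.
rewrite lslice_tprod.
have -> : rslice I (tprod x y) = x I *: y.
  by apply/ffunP => J; rewrite !ffunE /=.
by rewrite !linearZ /= !fscale_ffunE mulrA (mulrC (y K)).
Qed.

Lemma tprod_sumZl (T : finType) (f : T -> F) (x : T -> tens F n m p) (y : tens F n m q) :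
  tprod (\sum_i f i *: x i) y = \sum_i f i *: tprod (x i) y.
Proof.
apply/ffunP => -[I K]; rewrite ffunE !sum_ffunE mulr_suml.
by apply: eq_bigr => i _; rewrite !ffunE /GRing.scale /= mulrA.
Qed.

Lemma tprod_sumZr (T : finType) (f : T -> F) (x : tens F n m p) (y : T -> tens F n m q) :
  tprod x (\sum_i f i *: y i) = \sum_i f i *: tprod x (y i).
Proof.
apply/ffunP => -[I K]; rewrite ffunE !sum_ffunE mulr_sumr.
by apply: eq_bigr => i _; rewrite !ffunE /GRing.scale /= mulrCA.
Qed.

Lemma tprod_suml (T : finType) (x : T -> tens F n m p) (y : tens F n m q) :
  tprod (\sum_i x i) y = \sum_i tprod (x i) y.
Proof.
apply/ffunP => -[I K]; rewrite ffunE !sum_ffunE mulr_suml.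
by apply: eq_bigr => i _; rewrite !ffunE.
Qed.

Lemma tprod_sumr (T : finType) (x : tens F n m p) (y : T -> tens F n m q) :
  tprod x (\sum_i y i) = \sum_i tprod x (y i).
Proof.
apply/ffunP => -[I K]; rewrite ffunE !sum_ffunE mulr_sumr.
by apply: eq_bigr => i _; rewrite !ffunE.
Qed.

Lemma tprodDl (x1 x2 : tens F n m p) (y : tens F n m q) :
  tprod (x1 + x2) y = tprod x1 y + tprod x2 y.
Proof. by apply/ffunP => -[I K]; rewrite !ffunE mulrDl. Qed.

Lemma tprodDr (x : tens F n m p) (y1 y2 : tens F n m q) :
  tprod x (y1 + y2) = tprod x y1 + tprod x y2.
Proof. by apply/ffunP => -[I K]; rewrite !ffunE mulrDr. Qed.

Lemma tprod0l (y : tens F n m q) : tprod (0 : tens F n m p) y = 0.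
Proof. by apply/ffunP => -[I K]; rewrite !ffunE mul0r. Qed.

Lemma tprod0r (x : tens F n m p) : tprod x (0 : tens F n m q) = 0.
Proof. by apply/ffunP => -[I K]; rewrite !ffunE mulr0. Qed.

Lemma tprodZl (k : F) (x : tens F n m p) (y : tens F n m q) :
  tprod (k *: x) y = k *: tprod x y.
Proof. by apply/ffunP => -[I K]; rewrite !ffunE /GRing.scale /= mulrA. Qed.

Lemma mbasisE I K : mbasis F I K = tprod (basis F I) (basis F K).
Proof. by apply/ffunP => -[J L]; rewrite !ffunE /= -natrM mulnb. Qed.

Lemma xpre_sign N (L : mi n m N) b (c : 'I_N) :
  (-1) ^+ (b * (\sum_(c' < N | (c' < c)%N) par (L c')))%N
  = (-1) ^+ (b && xpre (oddsite L) c) :> F.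
Proof. by case: b; rewrite ?mul0n // mul1n signr_sum. Qed.

Lemma xtot_sign N (L : mi n m N) b :
  (-1) ^+ (b * (\sum_(c < N) par (L c)))%N = (-1) ^+ (b && xtot (oddsite L)) :> F.
Proof. by case: b; rewrite ?mul0n // mul1n signr_sum. Qed.

Lemma actbE b X I K : actb b X I K = sact b X (mbasis F I K).
Proof.
rewrite mbasisE sact_tprod !dop_basis psgn_basis tprod_suml tprodZl tprod_sumr.
rewrite scaler_sumr; congr (_ + _); apply: eq_bigr => a _.
  by rewrite tprod_sumZl; apply: eq_bigr => r _; rewrite mbasisE xpre_sign.
rewrite tprod_sumZr scaler_sumr; apply: eq_bigr => r _.
rewrite mbasisE scalerA mxE mulnDr exprD xpre_sign xtot_sign mulnb.
by rewrite !mulrA.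
Qed.

Lemma mact_sact b X w : Defs.mact b X w = sact b X w.
Proof.
rewrite /Defs.mact (eq_bigr (fun IK => w IK *: sact b X (mbasis F IK.1 IK.2))); last first.
  by move=> IK _; rewrite actbE.
under eq_bigr => IK _ do rewrite -linearZ /=.
rewrite -linear_sum /=; congr (sact b X _); apply/ffunP => -[J L].
rewrite sum_ffunE (bigD1 (J, L)) //= !ffunE /= !eqxx [_ *: _]mulr1 big1 ?addr0 //.
move=> [I K] /= ne; rewrite !ffunE /=; move: ne; rewrite xpair_eqE !(eq_sym I, eq_sym K).
by move/negPf->; apply: mulr0.
Qed.

Lemma mact0 b X : @Defs.mact F n m b X p q 0 = 0.
Proof. by rewrite mact_sact linear0. Qed.

Lemma mactDl b X Y w : Defs.mact b (X + Y) w = Defs.mact b X w + Defs.mact b Y w.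
Proof.
have dopD N A B (x : tens F n m N) : dop b (A + B) x = dop b A x + dop b B x.
  apply/ffunP => J; rewrite ffunE !dopE -big_split /=; apply: eq_bigr => a _.
  by rewrite -big_split /=; apply: eq_bigr => i _; rewrite mxE mulrDr mulrDl.
rewrite !mact_sact; apply/ffunP => -[I K]; rewrite [RHS]ffunE !sactE dualmxD !dopD.
by rewrite !fadd_ffunE mulrDr addrACA.
Qed.

(** An odd [Y] on the V-factors flips their total parity, hence also the sign with which [X] crosses
    them to reach the dual factors. *)
Lemma dop_cross X Y w I K : homogeneous true Y ->
  dop true Y [ffun J => (-1) ^+ xtot (oddsite J) * dop true X (rslice J w) K] I
  = - ((-1) ^+ xtot (oddsite I) * dop true X [ffun L => dop true Y (lslice L w) I] K).
Proof.
move=> hY; rewrite !dopE mulr_sumr -sumrN.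
under eq_bigr => a _.
  under eq_bigr => i _ do rewrite ffunE dopE !mulr_sumr.
  rewrite exchange_big /=.
  over.
rewrite exchange_big /=; apply: eq_bigr => c _.
rewrite mulr_sumr -sumrN.
under [RHS]eq_bigr => k _ do rewrite ffunE dopE !mulr_sumr -sumrN.
rewrite [RHS]exchange_big /=; apply: eq_bigr => a _.
under eq_bigr => i _ do rewrite !mulr_sumr.
rewrite exchange_big /=; apply: eq_bigr => k _.
rewrite !mulr_sumr -sumrN; apply: eq_bigr => i _.
rewrite !ffunE.
have [e|/hY ->] := eqVneq (par (I a) (+) par i) true; last by rewrite !(mulr0, mul0r, oppr0).
rewrite xtot_oddsite_upd -addbA e addbT signrN !(mulNr, mulrN); congr (- _).
rewrite !mulrA; congr (_ * _).
by rewrite -[RHS]mulrA [RHS]mulrC !mulrA.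
Qed.

(** The mixed terms cancel by [dop_cross]; on each side the anticommutator of derivations is the
    derivation of the anticommutator. *)
Lemma mact_anticomm X Y w : homogeneous true X -> homogeneous true Y ->
  Defs.mact true X (Defs.mact true Y w) + Defs.mact true Y (Defs.mact true X w)
  = Defs.mact false (X *m Y + Y *m X) w.
Proof.
move=> hX hY; rewrite !mact_sact; apply/ffunP => -[I K].
rewrite [LHS]ffunE !sactE /=.
have lE A J : lslice J (sact true A w) = dop true A (lslice J w) +
    [ffun I => (-1) ^+ xtot (oddsite I) * dop true (dualmx true A) (rslice I w) J].
  by apply/ffunP => I'; rewrite [LHS]ffunE sactE [RHS]ffunE [X in _ = _ + X]ffunE.
have rE A J : rslice J (sact true A w) = [ffun L => dop true A (lslice L w) J] +
    (-1) ^+ xtot (oddsite J) *: dop true (dualmx true A) (rslice J w).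
  by apply/ffunP => I'; rewrite [LHS]ffunE sactE !ffunE.
rewrite !lE !rE !linearD !linearZ /= !fadd_ffunE.
rewrite !dop_cross // !fscale_ffunE !mulrDr !mulrA -!signr_addb.
rewrite !addbb !mul1r -(dualmx_anticomm hX hY).
rewrite -dop_anticomm // -dop_anticomm; try exact: homogeneous_dual.
rewrite !fadd_ffunE.
ring.
Qed.

End MixedTensors.

(** * Young symmetrizers *)

Section Symmetrizers.
Variables (F : fieldType) (n m N : nat).
Implicit Types (x : tens F n m N) (I J : mi n m N) (row col : nat -> nat).
Implicit Types (s t : 'S_N).

Definition rsym row x : tens F n m N := \sum_(s in Rgrp N row) permact s x.
Definition casym col x : tens F n m N :=
  \sum_(t in Rgrp N col) sgnF F t *: permact t x.

Lemma rsym_is_linear row : linear (rsym row).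
Proof.
move=> k x y; rewrite /rsym scaler_sumr -big_split /=.
by apply: eq_bigr => s _; rewrite linearP.
Qed.
HB.instance Definition _ row :=
  GRing.isLinear.Build F (tens F n m N) (tens F n m N) _ (rsym row) (rsym_is_linear row).

Lemma casym_is_linear col : linear (casym col).
Proof.
move=> k x y; rewrite /casym scaler_sumr -big_split /=.
by apply: eq_bigr => s _; rewrite linearP scalerDr !scalerA mulrC.
Qed.
HB.instance Definition _ col :=
  GRing.isLinear.Build F (tens F n m N) (tens F n m N) _ (casym col) (casym_is_linear col).

Lemma ysymE row col x : ysym row col x = rsym row (casym col x).
Proof.
rewrite /casym linear_sum; apply: eq_bigr => t _.
by rewrite linearZ /= /rsym scaler_sumr.
Qed.

Lemma ysymtE row col x : ysymt row col x = casym col (rsym row x).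
Proof.
by apply: eq_bigr => t _; rewrite /rsym (linear_sum (permact t)) /= scaler_sumr.
Qed.

Lemma dop_rsym b A row x : homogeneous b A -> dop b A (rsym row x) = rsym row (dop b A x).
Proof.
by move=> hA; rewrite linear_sum; apply: eq_bigr => s _; rewrite permact_dop.
Qed.

Lemma dop_casym b A col x : homogeneous b A -> dop b A (casym col x) = casym col (dop b A x).
Proof.
by move=> hA; rewrite linear_sum; apply: eq_bigr => s _; rewrite permact_dop // linearZ.
Qed.

Lemma psgn_rsym b row x : psgn b (rsym row x) = rsym row (psgn b x).
Proof.
by rewrite linear_sum; apply: eq_bigr => s _; rewrite permact_psgn.
Qed.

Lemma psgn_casym b col x : psgn b (casym col x) = casym col (psgn b x).
Proof.
by rewrite linear_sum; apply: eq_bigr => s _; rewrite permact_psgn // linearZ.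
Qed.

Lemma ysym_is_linear row col : linear (@ysym F n m N row col).
Proof. by move=> k x y; rewrite !ysymE !linearP. Qed.
HB.instance Definition _ row col :=
  GRing.isLinear.Build F (tens F n m N) (tens F n m N) _ (@ysym F n m N row col)
    (ysym_is_linear row col).

Lemma ysymt_is_linear row col : linear (@ysymt F n m N row col).
Proof. by move=> k x y; rewrite !ysymtE !linearP. Qed.
HB.instance Definition _ row col :=
  GRing.isLinear.Build F (tens F n m N) (tens F n m N) _ (@ysymt F n m N row col)
    (ysymt_is_linear row col).

Lemma dop_ysym b A row col x : homogeneous b A ->
  dop b A (ysym row col x) = ysym row col (dop b A x).
Proof. by move=> hA; rewrite !ysymE dop_rsym // dop_casym. Qed.

Lemma dop_ysymt b A row col x : homogeneous b A ->
  dop b A (ysymt row col x) = ysymt row col (dop b A x).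
Proof. by move=> hA; rewrite !ysymtE dop_casym // dop_rsym. Qed.

Lemma psgn_ysym b row col x : psgn b (ysym row col x) = ysym row col (psgn b x).
Proof. by rewrite !ysymE psgn_rsym psgn_casym. Qed.

(** * Invariance under row groups and vanishing criteria *)

Lemma Rgrp_mull row s t : s \in Rgrp N row -> ((s * t)%g \in Rgrp N row) = (t \in Rgrp N row).
Proof.
rewrite !inE => /forallP hs; apply/forallP/forallP => h k.
  by have := h (s^-1%g k); have := hs (s^-1%g k); rewrite permM permKV => /eqP ->.
by rewrite permM (eqP (h _)).
Qed.

Lemma Rgrp_mulr row s t : t \in Rgrp N row -> ((s * t)%g \in Rgrp N row) = (s \in Rgrp N row).
Proof.
rewrite !inE => /forallP ht; apply: eq_forallb => k.
by rewrite permM (eqP (ht _)).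
Qed.

Lemma Rgrp_tperm row (k l : 'I_N) : row k = row l -> tperm k l \in Rgrp N row.
Proof.
by move=> e; rewrite inE; apply/forallP => c; case: tpermP => [->|->|]; rewrite ?e.
Qed.

Lemma permact_rsym row s x : s \in Rgrp N row -> permact s (rsym row x) = rsym row x.
Proof.
move=> hs; rewrite linear_sum [RHS](reindex_inj (mulIg s)) /=.
apply: eq_big => t; first by rewrite Rgrp_mulr.
by move=> _; rewrite permactM.
Qed.

Lemma permact_basis s I :
  permact s (basis F I) = (-1) ^+ xinv s^-1%g (oddsite (pact s I)) *: basis F (pact s I).
Proof.
apply/ffunP => J; rewrite permactE !ffunE /GRing.scale /=.
case: (J =P pact s I) => [->|ne]; first by rewrite pactK eqxx.
case: eqP => [eI|_]; last by rewrite !mulr0.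
by case: ne; rewrite -eI pactKV.
Qed.

Lemma permact_tperm_basis I k l : k != l -> I k = I l ->
  permact (tperm k l) (basis F I) = (-1) ^+ par (I k) *: basis F I.
Proof.
move=> nkl e.
have eI : pact (tperm k l) I = I.
  by apply/ffunP => c; rewrite ffunE tpermV; case: tpermP => [->|->|].
by rewrite permact_basis eI xinv_tperm // /oddsite e.
Qed.

Lemma eq_oppr0 (V : lmodType F) (v : V) : [pchar F] =i pred0 -> v = - v -> v = 0.
Proof.
move=> HF e; have : 2%:R *: v = 0 by rewrite scaler_nat mulr2n {2}e subrr.
by move/eqP; rewrite scaler_eq0 (proj1 (pcharf0P F) HF) => /eqP.
Qed.

(** The transposition of [k] and [l] lies in the column group and fixes the basis tensor, while its
    signature is -1. Letting it act first shows that the antisymmetrized tensor equals its own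
    negative. *)
Lemma casym_basis0 col I k l : [pchar F] =i pred0 -> k != l -> I k = I l ->
  col k = col l -> ~~ par (I k) -> casym col (basis F I) = 0.
Proof.
move=> HF nkl e ec ev; apply: eq_oppr0 => //.
rewrite {1}/casym (reindex_inj (mulgI (tperm k l))) /= -sumrN.
apply: eq_big => t; first by rewrite Rgrp_mull // Rgrp_tperm.
move=> _; rewrite -permactM permact_tperm_basis // (negPf ev) expr0 scale1r.
by rewrite /sgnF odd_mul_tperm nkl addTb signrN scaleNr.
Qed.

(** Exchanging two equal odd labels negates the basis tensor, which contradicts row symmetry unless
    the sum is zero. *)
Lemma rsym_basis0 row I k l : [pchar F] =i pred0 -> k != l -> I k = I l ->
  row k = row l -> par (I k) -> rsym row (basis F I) = 0.
Proof.
move=> HF nkl e er od; apply: eq_oppr0 => //.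
rewrite {1}/rsym (reindex_inj (mulgI (tperm k l))) /= -sumrN.
apply: eq_big => t; first by rewrite Rgrp_mull // Rgrp_tperm.
by move=> _; rewrite -permactM permact_tperm_basis // od expr1 scaleN1r linearN.
Qed.

Lemma card_even_labels : #|[set i : 'I_(n + m) | ~~ par i]| = n.
Proof.
rewrite -[RHS]card_ord -cardsT -(card_imset _ (@lshift_inj n m)); apply: eq_card => i.
rewrite !inE; case: (split_ordP i) => j ->; rewrite /par /=.
  by rewrite -ltnNge ltn_ord imset_f.
by rewrite leq_addr; apply/esym/negbTE/negP => /imsetP[k _ /eqP]; rewrite eq_rlshift.
Qed.

(* A column of the tableau can hold each even label at most once, so at most
   [n * w] even entries fit into [w] columns. *)
Lemma casym_rsym_basis0 row col I width : [pchar F] =i pred0 ->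
  (forall k : 'I_N, col k < width)%N -> (width * n < #|[set k | ~~ par (I k)]|)%N ->
  casym col (rsym row (basis F I)) = 0.
Proof.
move=> HF hw hc; rewrite linear_sum big1 // => s _.
rewrite permact_basis linearZ /=; set J := pact s I.
have hJ : (width * n < #|[set k | ~~ par (J k)]|)%N.
  rewrite -(card_imset _ (@perm_inj _ s)) /= in hc.
  apply: leq_trans hc _; apply: subset_leq_card; apply/subsetP => k /imsetP[c].
  by rewrite !inE => hc ->; rewrite ffunE permK.
(* Pigeonhole: there are [width * n] pairs of a column and an even label, fewer than the even sites.
   A collision is a repeated even label in one column. *)
pose f k := (Ordinal (hw k), J k).
pose E := [set k | ~~ par (J k)].
have: ~~ dinjectiveb f (mem E).
  apply: contraL hJ => /dinjectiveP finj; rewrite -leqNgt -(card_in_imset finj).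
  apply: (@leq_trans #|setX [set: 'I_width] [set i : 'I_(n + m) | ~~ par i]|).
    apply: subset_leq_card; apply/subsetP => _ /imsetP[k hk ->].
    by move: hk; rewrite !inE.
  by rewrite cardsX cardsT card_ord card_even_labels.
case/dinjectivePn => k kE [l]; rewrite !inE in kE *.
move=> /andP[nlk _] [ec eJ].
by rewrite (casym_basis0 (I := J) (k := k) (l := l)) ?scaler0 // eq_sym.
Qed.

End Symmetrizers.

(** * Derivations on concatenated multi-indices *)

Section Concatenation.
Variables (n m p q : nat).
Implicit Types (I : mi n m p) (L : mi n m q).

Lemma catmiL I L a : catmi I L (lshift q a) = I a.
Proof. by rewrite ffunE (unsplitK (inl a)). Qed.

Lemma catmiR I L a : catmi I L (rshift p a) = L a.
Proof. by rewrite ffunE (unsplitK (inr a)). Qed.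

Lemma upd_catL I L a r : upd (catmi I L) (lshift q a) r = catmi (upd I a r) L.
Proof.
apply/ffunP => k; case: (split_ordP k) => j ->; rewrite ?catmiL ?catmiR ffunE.
  by rewrite eq_lshift catmiL ffunE.
by rewrite eq_rlshift catmiR.
Qed.

Lemma upd_catR I L a r : upd (catmi I L) (rshift p a) r = catmi I (upd L a r).
Proof.
apply/ffunP => k; case: (split_ordP k) => j ->; rewrite ?catmiL ?catmiR ffunE.
  by rewrite eq_lrshift catmiL.
by rewrite eq_rshift catmiR ffunE.
Qed.

Lemma xtot_cat I L : xtot (oddsite (catmi I L)) = xtot (oddsite I) (+) xtot (oddsite L).
Proof.
rewrite /xtot big_split_ord /=; congr (_ (+) _); apply: eq_bigr => a _.
  by rewrite /oddsite catmiL.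
by rewrite /oddsite catmiR.
Qed.

Lemma xpre_catL I L a :
  xpre (oddsite (catmi I L)) (lshift q a) = xpre (oddsite I) a.
Proof.
rewrite /xpre big_split_ord /= [X in _ (+) X]big1 => [|c _].
  by rewrite addbF; apply: eq_bigr => c _; rewrite /oddsite catmiL.
by rewrite ltnNge (leq_trans (ltnW (ltn_ord a)) (leq_addr _ _)).
Qed.

Lemma xpre_catR I L a :
  xpre (oddsite (catmi I L)) (rshift p a) = xtot (oddsite I) (+) xpre (oddsite L) a.
Proof.
rewrite /xpre big_split_ord /=; congr (_ (+) _); apply: eq_bigr => c _.
  by rewrite /oddsite catmiL (leq_trans (ltn_ord c) (leq_addr _ _)).
by rewrite /oddsite catmiR ltn_add2l.
Qed.

Lemma dop_basis_cat (F : fieldType) b (A : 'M[F]_(n + m)) I L :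
  dop b A (basis F (catmi I L)) =
  \sum_(a < p) \sum_r ((-1) ^+ (b && xpre (oddsite I) a) * A r (I a))
      *: basis F (catmi (upd I a r) L)
  + \sum_(a < q) \sum_r
      ((-1) ^+ (b && (xtot (oddsite I) (+) xpre (oddsite L) a)) * A r (L a))
      *: basis F (catmi I (upd L a r)).
Proof.
rewrite dop_basis big_split_ord /=; congr (_ + _); apply: eq_bigr => a _;
  apply: eq_bigr => r _.
  by rewrite xpre_catL catmiL upd_catL.
by rewrite xpre_catR catmiR upd_catR.
Qed.

End Concatenation.

(** * The sign [alpha] and the canonical tensor *)

Section Contraction.
Variables (F : fieldType) (n m N : nat).
Implicit Types (L : mi n m N) (X : 'M[F]_(n + m)) (b : bool).

(** Under the order-reversing permutation every pair of odd entries is an inversion. Hence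
    [xinv_toggle] also governs changes of [alpha]. *)
Lemma alphaE L : (-1) ^+ alpha L = (-1) ^+ xinv (perm (@rev_ord_inj N)) (oddsite L) :> F.
Proof.
rewrite /alpha -signr_odd (big_morph odd oddD (erefl _)) /=.
congr (_ ^+ nat_of_bool _); apply: eq_bigr => a _.
rewrite (big_morph odd oddD (erefl _)) big_mkcond /=; apply: eq_bigr => c _.
rewrite !permE /= ltn_sub2lE // ltnS oddM !oddb /oddsite.
by case: ifP => //= ->.
Qed.

(** A parity change at [a] creates or destroys one pair for each odd entry elsewhere; their number
    has parity [xtot (oddsite L) (+) par (L a)]. *)
Lemma alpha_upd b L a r : par (L a) (+) par r = b ->
  (-1) ^+ alpha (upd L a r) =
  (-1) ^+ alpha L * (-1) ^+ (b && (xtot (oddsite L) (+) par (L a))) :> F.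
Proof.
case: b => e; last first.
  rewrite mulr1 !alphaE; congr (_ ^+ nat_of_bool _); apply: eq_xinv => c.
  case: (eqVneq c a) => [->|nc]; rewrite ?oddsite_upd_at ?oddsite_upd_ne // /oddsite.
  by move: e; do 2!case: (par _).
rewrite !alphaE -signr_addb; congr (_ ^+ nat_of_bool _).
rewrite (xinv_toggle _ (p := oddsite L) (c := a)); first last.
- by rewrite oddsite_upd_at /oddsite; move: e; do 2!case: (par _).
- by move=> d; apply: oddsite_upd_ne.
rewrite -addbA; congr (_ (+) _).
rewrite [xpre _ (perm _ _)](reindex_inj (@perm_inj _ (perm (@rev_ord_inj N)))) /=.
under eq_bigr => c _ do rewrite permK !permE /= ltn_sub2lE // ltnS.
rewrite /xpre -big_split /xtot (bigD1 a) //= [in RHS](bigD1 a) //=.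
rewrite !ltnn /= -/(oddsite L a) (addbC (oddsite L a)) -addbA addbb addbF.
apply: eq_bigr => c; rewrite -val_eqE /=; case: ltngtP => //= _ _.
by rewrite addbF.
Qed.

(* Invariance of the canonical tensor [\sum_L (-1)^alpha(L) v_L (x) v*_L] *)
Lemma contraction_invariant (V : lmodType F) b X (G : mi n m N -> mi n m N -> V) :
  homogeneous b X ->
  \sum_L (-1) ^+ alpha L *: (\sum_(a < N) \sum_r
     ((-1) ^+ (b && xpre (oddsite L) a) * X r (L a)) *: G (upd L a r) L
    + (-1) ^+ (b && xtot (oddsite L)) *: \sum_(a < N) \sum_r
     ((-1) ^+ (b && xpre (oddsite L) a) * dualmx b X r (L a)) *: G L (upd L a r)) = 0.
Proof.
move=> hX.
under eq_bigr => L _ do rewrite scalerDr scalerA !scaler_sumr.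
rewrite big_split /= exchange_big [X in _ + X]exchange_big /= -big_split /=.
apply: big1 => a _.
under eq_bigr => L _ do rewrite scaler_sumr.
under [X in _ + X]eq_bigr => L _ do rewrite scaler_sumr.
(* After the exchange both sums run over [G (upd L a r) L], and the coefficients cancel term by
   term. *)
rewrite [X in _ + X](sum_upd_swap a) -big_split /= big1 // => L _.
rewrite -big_split /= big1 // => r _.
rewrite upd_upd upd_id upd_at !scalerA -scalerDl mxE.
have [e|/hX ->] := eqVneq (par r (+) par (L a)) b; last by rewrite !(mulr0, oppr0, addr0) scale0r.
rewrite addbC in e; rewrite (alpha_upd e) xtot_oddsite_upd xpre_oddsite_upd ltnn addbF.
apply/eqP; rewrite scaler_eq0; apply/orP; left; apply/eqP.
rewrite -addbA e; case: b e {hX} => /= e; last by ring.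
move: e; case: (xtot _); case: (par (L a)); case: (par r) => // _;
rewrite /= ?expr0 ?expr1; ring.
Qed.

End Contraction.

(** * Vectors killed by the raising operators *)

Section Singular.
Variables (F : fieldType) (n m : nat).
Hypothesis HF : [pchar F] =i pred0.

Definition raising (Y : 'M[F]_(n + m)) : Prop :=
  forall i j, ~~ (~~ par i && par j) -> Y i j = 0.

Lemma raising_homogeneous Y : raising Y -> homogeneous true Y.
Proof. by move=> hY i j e; apply: hY; move: e; do 2!case: (par _). Qed.

Lemma raising_delta i j : ~~ par i -> par j -> raising (delta_mx i j).
Proof.
move=> pi pj k l; rewrite mxE; case: eqP => [->|//]; case: eqP => [->|//].
by rewrite pi pj.
Qed.

(** The transposition of [k] and [c] fixes [x], fixes [J], carries no sign because the label is
    even, and moves the operator from one site to the other. *)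
Lemma dsite_row_sym N row (x : tens F n m N) b (Y : 'M[F]_(n + m)) (J : mi n m N) (k c : 'I_N) :
  homogeneous b Y ->
  (forall s, s \in Rgrp N row -> permact s x = x) ->
  row k = row c -> J k = J c -> ~~ par (J k) ->
  dsite b Y c x J = dsite b Y k x J.
Proof.
move=> hY hx er eJ ev; have [->//|nkc] := eqVneq k c.
rewrite -{1}(hx (tperm k c)) ?Rgrp_tperm // -{1}(tpermL k c) -permact_dsite // permactE.
have -> : pact (tperm k c)^-1%g J = J.
  by apply/ffunP => d; rewrite pactE; case: tpermP => [->|->|].
by rewrite xinv_tperm // /oddsite -?eJ // (negPf ev) mul1r.
Qed.

(* The diagonal sites of [I] are those carrying the even label equal to their
   row number. Raising an odd entry of row [i] to the label [i] produces a
   multi-index with one more diagonal site, whose other preimages under the same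
   operator are either row permutations of [I] or have more diagonal sites. *)
Lemma raising_invariant_eq0 p q (row : nat -> nat) (w : mtens F n m p q) :
  (forall k : 'I_p, row k < n)%N ->
  (forall K s, s \in Rgrp p row -> permact s (lslice K w) = lslice K w) ->
  (forall (I : mi n m p) K, (forall a, ~~ par (I a)) -> w (I, K) = 0) ->
  (forall Y, raising Y -> Defs.mact true Y w = 0) -> w = 0.
Proof.
move=> hrow hsym hev hY.
pose odds (I : mi n m p) := [set a | par (I a)].
pose diag (I : mi n m p) := [set k : 'I_p | I k == row k :> nat].
suff main c : forall I K, (#|odds I| <= c)%N -> w (I, K) = 0.
  by apply/ffunP => -[I K]; rewrite [RHS]ffunE (main #|odds I|).
elim: c => [|c IHc] I K.
  rewrite leqn0 cards_eq0 => /eqP o0; apply: hev => a.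
  by have := in_set0 a; rewrite -o0 inE => ->.
(* Descending induction on the number of diagonal sites, with [p.+1 <= #|diag I| + d]; the case
   [d = 0] is void since there are only [p] sites. *)
move: {2}(p.+1) (leq_addl #|diag I| p.+1) => d.
elim: d I => [|d IHd] I.
  by rewrite addn0 leqNgt (leq_ltn_trans (max_card _)) // card_ord.
move=> hd hc.
have [k0 ok0|ev] := pickP (mem (odds I)); last first.
  by apply: hev => a; have := ev a; rewrite !inE => ->.
rewrite !inE in ok0.
have a0P : (row k0 < n + m)%N by rewrite ltn_addr.
pose a0 := Ordinal a0P; set j := I k0.
have a0e : ~~ par a0 by rewrite /par -ltnNge /=.
have rY : raising (delta_mx a0 j) by apply: raising_delta.
pose J := upd I k0 a0.
have Jk0 : J k0 = a0 by rewrite upd_at.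
have oJ : (#|odds J| <= c)%N.
  rewrite -ltnS (leq_trans _ hc) //; apply: proper_card; apply/properP; split.
    apply/subsetP => a; rewrite !inE; have [->|na] := eqVneq a k0.
      by rewrite Jk0 (negPf a0e).
    by rewrite upd_ne.
  by exists k0; rewrite !inE ?ok0 // Jk0.
have dJ : (#|diag I| < #|diag J|)%N.
  apply: proper_card; apply/properP; split.
    apply/subsetP => a; rewrite !inE; have [->|na] := eqVneq a k0.
      by rewrite Jk0 eqxx.
    by rewrite upd_ne.
  exists k0; rewrite !inE ?Jk0 //; apply: contraL ok0 => /eqP e.
  by rewrite /par -ltnNge e.
have := congr1 (fun u : mtens F n m p q => u (J, K)) (hY _ rY).
(* The dual part evaluates [w] only over the V-index [J], which has fewer odd entries than [I]. *)
rewrite mact_sact sactE [RHS]ffunE [X in _ + _ * X](_ : _ = 0); last first.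
  rewrite dopE big1 // => a _; rewrite big1 // => i _.
  by rewrite ffunE IHc ?mulr0.
rewrite mulr0 addr0 sum_ffunE.
pose x := lslice K w; rewrite -/x.
pose good (a : 'I_p) := (J a == a0) && (row a == row k0).
have site a : dsite true (delta_mx a0 j) a x J
    = if good a then dsite true (delta_mx a0 j) k0 x J else 0.
  rewrite /good; case: (eqVneq (J a) a0) => /= [Ja|nJ]; last first.
    by rewrite dsiteE big1 // => i _; rewrite mxE (negPf nJ) mulr0 mul0r.
  case: (eqVneq (row a) (row k0)) => [er|ner].
    apply: (dsite_row_sym (row := row)) => //.
    - exact: raising_homogeneous.
    - exact: hsym.
    - by rewrite Jk0.
    by rewrite Jk0.
  (* A site labelled [a0] in another row is not diagonal in [J], so giving it the label [j] keeps
     all diagonal sites of [J], and [IHd] applies. *)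
  rewrite dsiteE big1 // => i _; rewrite mxE; have [->|_] := eqVneq i j; last first.
    by rewrite andbF mulr0 mul0r.
  rewrite [x _]ffunE IHd ?mulr0 //.
    apply: (leq_trans hd); rewrite addnS -addSn leq_add2r (leq_trans dJ) //.
    apply: subset_leq_card; apply/subsetP => e; rewrite !inE.
    have [->|ne] := eqVneq e a; last by rewrite upd_ne.
    by rewrite Ja /= eq_sym (negPf ner).
  apply: (@leq_trans #|a |: odds J|); last first.
    by rewrite cardsU1 (leq_add (leq_b1 _) oJ).
  apply: subset_leq_card; apply/subsetP => e; rewrite !inE.
  by have [->|ne] := eqVneq e a; last by rewrite upd_ne.
(* The equation becomes the number of good sites times [w (I, K)] up to sign; this number is
   positive since [k0] is good, hence invertible in characteristic 0. *)
rewrite (eq_bigr _ (fun a _ => site a)) -big_mkcond /= sumr_const.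
move/eqP; rewrite -scaler_nat scaler_eq0 (proj1 (pcharf0P F) HF).
case/orP => [/eqP c0|].
  by have := card0_eq c0 k0; rewrite !unfold_in Jk0 !eqxx.
rewrite dsiteE (bigD1 j) //= big1 => [|i nij]; last first.
  by rewrite mxE (negPf nij) andbF mulr0 mul0r.
rewrite addr0 mxE Jk0 !eqxx mulr1 /J upd_upd /j upd_id [x _]ffunE.
by rewrite mulf_eq0 signr_eq0 => /eqP.
Qed.

End Singular.

(** * The invariant element *)

Section MasterFormula.
Variables (F : fieldType) (n m p N q : nat).
Variables (rs cs rt ct : nat -> nat) (I : mi n m p) (J : mi n m q).
Hypothesis Iev : forall a, ~~ par (I a).

Local Notation S K := (ysym rs cs (basis F K)).
Local Notation T K := (ysymt rt ct (basis F K)).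

Definition invelt : mtens F n m (p + N) (N + q) :=
  \sum_(L : mi n m N) (-1) ^+ alpha L *: tprod (S (catmi I L)) (T (catmi L J)).

Lemma mact_invelt b X : homogeneous b X ->
  Defs.mact b X invelt =
  \sum_(L : mi n m N) (-1) ^+ alpha L *:
    (\sum_(a < p) \sum_r X r (I a)
       *: tprod (S (catmi (upd I a r) L)) (T (catmi L J))
     + \sum_(c < q) \sum_r ((-1) ^+ (b && xpre (oddsite J) c) * dualmx b X r (J c))
       *: tprod (S (catmi I L)) (T (catmi L (upd J c r)))).
Proof.
move=> hX; have hX' := homogeneous_dual hX.
have oI : oddsite I =1 xpred0 by move=> a; apply/negbTE/Iev.
have preI a : xpre (oddsite I) a = false.
  by rewrite /xpre big1 // => c _; rewrite oI andbF.
have totI : xtot (oddsite I) = false by rewrite /xtot big1 // => c _; rewrite oI.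
rewrite mact_sact linear_sum /=.
pose G (L L' : mi n m N) := tprod (S (catmi I L)) (T (catmi L' J)).
(* Zero is added in the form of all terms hitting an entry of [L] on either side, so that the
   Leibniz expansion can be compared for each [L]. *)
rewrite -[RHS]addr0 -[X in _ = _ + X](contraction_invariant G hX) -big_split /=.
apply: eq_bigr => L _; rewrite linearZ /= -scalerDr; congr (_ *: _).
rewrite sact_tprod.
have -> : dop b X (S (catmi I L)) =
    \sum_(a < p) \sum_r X r (I a) *: S (catmi (upd I a r) L) +
    \sum_(a < N) \sum_r ((-1) ^+ (b && xpre (oddsite L) a) * X r (L a))
       *: S (catmi I (upd L a r)).
  rewrite dop_ysym // dop_basis_cat totI linearD /= !(linear_sum (ysym rs cs)) /=.
  congr (_ + _); apply: eq_bigr => a _; rewrite (linear_sum (ysym rs cs));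
    apply: eq_bigr => r _; rewrite linearZ //=.
  by rewrite preI andbF mul1r.
have -> : dop b (dualmx b X) (T (catmi L J)) =
    \sum_(a < N) \sum_r ((-1) ^+ (b && xpre (oddsite L) a) * dualmx b X r (L a))
       *: T (catmi (upd L a r) J) +
    \sum_(c < q) \sum_r ((-1) ^+ (b && (xtot (oddsite L) (+) xpre (oddsite J) c))
       * dualmx b X r (J c)) *: T (catmi L (upd J c r)).
  rewrite dop_ysymt // dop_basis_cat linearD /= !(linear_sum (ysymt rt ct)) /=.
  congr (_ + _); apply: eq_bigr => a _; rewrite (linear_sum (ysymt rt ct));
    by apply: eq_bigr => r _; rewrite linearZ.
have -> : psgn b (S (catmi I L)) = (-1) ^+ (b && xtot (oddsite L)) *: S (catmi I L).
  by rewrite psgn_ysym psgn_basis xtot_cat totI linearZ.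
rewrite tprodDl tprodZl tprodDr scalerDr !tprod_suml !tprod_sumr.
rewrite [X in _ + X = _]addrC addrACA; congr (_ + _ + (_ + _ *: _));
  rewrite ?scaler_sumr; apply: eq_bigr => a _; rewrite ?tprod_sumZl ?tprod_sumZr //.
(* To reach [J], [X] crosses the entries of [L] once on each side, so this sign cancels. *)
rewrite scaler_sumr; apply: eq_bigr => r _; rewrite scalerA mulrA -signr_addb.
by case: b {hX hX'}; rewrite //= addbA addbb.
Qed.

End MasterFormula.

(** * Label multiplicities in [Ih] and [Jh] *)

Lemma sum_modn (V : nmodType) (g : nat -> V) n h :
  \sum_(a < n * h) g (a %% n)%N = (\sum_(i < n) g i) *+ h.
Proof.
elim: h => [|h IH]; first by rewrite muln0 big_ord0.
rewrite mulnS big_split_ord /= mulrS; congr (_ + _).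
  by apply: eq_bigr => i _; rewrite modn_small.
by rewrite -IH; apply: eq_bigr => i _; rewrite modnDl.
Qed.

Lemma sum_divn (V : nmodType) (g : nat -> V) h m :
  \sum_(c < h * m) g (c %/ h)%N = (\sum_(j < m) g j) *+ h.
Proof.
elim: m => [|m IH]; first by rewrite muln0 !big_ord0 mul0rn.
rewrite mulnSr big_split_ord /= IH big_ord_recr /= mulrnDl; congr (_ + _).
rewrite -[X in _ *+ X](card_ord h) -sumr_const; apply: eq_bigr => i _ /=.
by rewrite mulnC divnMDl ?(leq_ltn_trans _ (ltn_ord i)) // divn_small // addn0.
Qed.

(** * Even, raising and lowering operators on the element *)

Section Invariance.
Variables (F : fieldType) (n m h : nat).
Hypothesis HF : [pchar F] =i pred0.
Implicit Types (X : 'M[F]_(n + m)) (L : mi n m (n * m)).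

Local Notation Ihn := (Ih n m h).
Local Notation Jhn := (Jh n m h).
Local Notation S K := (ysym (s_row n) (s_col n) (basis F K)).
Local Notation T K := (ysymt (t_row n m h) (t_col n m h) (basis F K)).
Local Notation w :=
  (@invelt F n m (n * h) (n * m) (h * m) (s_row n) (s_col n) (t_row n m h) (t_col n m h)
     Ihn Jhn).

Lemma val_Ih a : Ihn a = (a %% n)%N :> nat.
Proof. by rewrite ffunE. Qed.

Lemma val_Jh c : Jhn c = (n + c %/ h)%N :> nat.
Proof. by rewrite ffunE. Qed.

Lemma par_Ih a : ~~ par (Ihn a).
Proof.
have := leq_ltn_trans (leq0n a) (ltn_ord a); rewrite muln_gt0 => /andP[n0 _].
by rewrite /par val_Ih -ltnNge ltn_pmod.
Qed.

Lemma par_Jh c : par (Jhn c).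
Proof. by rewrite /par val_Jh leq_addr. Qed.

(** Each of the first [h] columns of [s] carries every even label once; a replacement repeats [r] in
    its column, at the site [a']. *)
Lemma ysym_upd_Ih0 (a : 'I_(n * h)) r L : ~~ par r -> r != Ihn a ->
  S (catmi (upd Ihn a r) L) = 0.
Proof.
rewrite {1}/par -ltnNge => rn nr.
have hb : (a %/ n * n + r < n * h)%N.
  have : (a %/ n < h)%N.
    by rewrite ltn_divLR ?(leq_ltn_trans _ rn) // (leq_trans (ltn_ord a)) // mulnC.
  by move=> lt; nia.
pose a' := Ordinal hb.
have ea' : Ihn a' = r by apply: val_inj; rewrite /= val_Ih /= modnMDl modn_small.
have na : a' != a by apply: contraNneq nr => <-; rewrite ea'.
rewrite ysymE (casym_basis0 (k := lshift _ a) (l := lshift _ a')) ?linear0 //.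
- by rewrite eq_lshift eq_sym.
- by rewrite !catmiL upd_at upd_ne.
- by rewrite /s_col /= divnMDl ?(leq_ltn_trans _ rn) // (divn_small rn) addn0.
by rewrite catmiL upd_at /par -ltnNge.
Qed.

(** Each of the last [h] rows of [t] carries every odd label once; a replacement repeats [r] in its
    row, at the site [c']. *)
Lemma ysymt_upd_Jh0 (c : 'I_(h * m)) r L : par r -> r != Jhn c ->
  T (catmi L (upd Jhn c r)) = 0.
Proof.
rewrite {1}/par => rn nr.
have h0 : (0 < h)%N.
  by have := leq_ltn_trans (leq0n c) (ltn_ord c); rewrite muln_gt0 => /andP[].
have hc := ltn_pmod c h0.
have hb : ((r - n) * h + c %% h < h * m)%N.
  have := ltn_ord r; nia.
pose c' := Ordinal hb.
have ec' : Jhn c' = r.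
  by apply: val_inj; rewrite /= val_Jh /= divnMDl // (divn_small hc) addn0 subnKC.
have nc : c' != c by apply: contraNneq nr => <-; rewrite ec'.
rewrite ysymtE (rsym_basis0 (k := rshift _ c) (l := rshift _ c')) ?linear0 //.
- by rewrite eq_rshift eq_sym.
- by rewrite !catmiR upd_at upd_ne.
- by rewrite /t_row /= !ltnNge !leq_addr /= !addKn modnMDl modn_mod.
by rewrite catmiR upd_at /par.
Qed.

Lemma t_col_lt k : (k < n * m + h * m)%N -> (t_col n m h k < m)%N.
Proof.
rewrite /t_col; case: (ltnP k (n * m)) => [lt _|le lt].
  by rewrite ltn_divLR 1?mulnC //; move: lt; case: (n).
have h0 : (0 < h)%N by move: lt; case: (h) => //; rewrite mul0n addn0 ltnNge le.
by rewrite ltn_divLR // mulnC; lia.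
Qed.

(** The [n * m] entries of [L] together with [r] are one even entry too many for the [m] columns of
    [t]. *)
Lemma ysymt_even0 (c : 'I_(h * m)) r L : (forall a, ~~ par (L a)) -> ~~ par r ->
  T (catmi L (upd Jhn c r)) = 0.
Proof.
move=> Lev rev; rewrite ysymtE (@casym_rsym_basis0 F n m _ _ _ _ m) //; first by move=> k; apply: t_col_lt.
set K := catmi _ _.
have sub : rshift (n * m) c |: [set lshift (h * m) a | a in [set: 'I_(n * m)]]
    \subset [set k | ~~ par (K k)].
  apply/subsetP => k; rewrite !inE => /orP[/eqP ->|/imsetP[a _ ->]].
    by rewrite catmiR upd_at.
  by rewrite catmiL.
apply: leq_trans (subset_leq_card sub).
rewrite cardsU1 card_imset ?cardsT ?card_ord; last exact: lshift_inj.
rewrite (_ : _ \notin _) ?add1n 1?mulnC //.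
by apply/negP => /imsetP[a _ /eqP]; rewrite eq_rlshift.
Qed.

(** Symmetrizers only permute entries, so an odd entry of [K] persists in every basis tensor that
    occurs. *)
Lemma ysym_all_even0 N row col (I K : mi n m N) a :
  (forall c, ~~ par (I c)) -> par (K a) -> ysym row col (basis F K) I = 0.
Proof.
move=> Iev Ka; rewrite /ysym sum_ffunE big1 // => t _; rewrite sum_ffunE big1 // => s _.
rewrite fscale_ffunE permactM permactE [basis _ _ _]ffunE.
case: eqP => [eK|_]; last by rewrite !mulr0.
by move: Ka; rewrite -eK pactE (negPf (Iev _)).
Qed.

Lemma str_split X :
  str X = \sum_(i < n) X (lshift m i) (lshift m i) - \sum_(j < m) X (rshift n j) (rshift n j).
Proof.
rewrite /str big_split_ord /= -sumrN; congr (_ + _); apply: eq_bigr => i _.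
  by rewrite /par /= leqNgt ltn_ord mul1r.
by rewrite /par /= leq_addr mulN1r.
Qed.

(** Only diagonal terms survive: each even label occurs [h] times in [Ih], and each odd label [h]
    times in [Jh], there with the minus sign of the dual action. *)
Lemma mact_even X : homogeneous false X -> Defs.mact false X w = (str X *+ h) *: w.
Proof.
move=> hX; rewrite (mact_invelt _ _ _ _ _ _ par_Ih hX) /invelt scaler_sumr.
apply: eq_bigr => L _; rewrite scalerA mulrC -scalerA; congr (_ *: _).
(* The diagonal of [X] is extended by 0 to all naturals, so that [sum_modn] and [sum_divn] apply. *)
pose g k := if insub k is Some i then X i i else 0.
have gE (i : 'I_(n + m)) : X i i = g (val i) by rewrite /g valK.
have -> : str X *+ h = \sum_a X (Ihn a) (Ihn a) - \sum_c X (Jhn c) (Jhn c).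
  rewrite str_split mulrnBl; congr (_ - _).
    rewrite (eq_bigr (fun i : 'I_n => g i)) -?sum_modn => [|i _]; last by rewrite gE.
    by apply: eq_bigr => a _; rewrite gE /= val_Ih.
  rewrite (eq_bigr (fun i : 'I_m => g (n + i)%N)) -?(sum_divn (fun k => g (n + k)%N)) => [|i _].
    by apply: eq_bigr => a _; rewrite gE /= val_Jh.
  by rewrite gE.
rewrite scalerBl !scaler_suml -sumrN; congr (_ + _); apply: eq_bigr => a _.
  rewrite (bigD1 (Ihn a)) //= upd_id big1 ?addr0 // => r nr.
  have [pr|pr] := boolP (par r).
    by rewrite hX ?scale0r // pr (negPf (par_Ih a)).
  by rewrite ysym_upd_Ih0 // tprod0l scaler0.
rewrite (bigD1 (Jhn a)) //= upd_id big1 ?addr0 => [|r nr].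
  by rewrite mxE !mul1r scaleNr.
have [pr|pr] := boolP (par r).
  by rewrite ysymt_upd_Jh0 // tprod0r scaler0.
by rewrite mxE hX ?mulr0 ?oppr0 ?mulr0 ?scale0r // (negPf pr) par_Jh.
Qed.

(** A raising [X] kills even basis vectors, and its dual action kills odd dual basis vectors; [Ih]
    is all even and [Jh] all odd. *)
Lemma mact_raising X : raising X -> Defs.mact true X w = 0.
Proof.
move=> rX; rewrite (mact_invelt _ _ _ _ _ _ par_Ih (raising_homogeneous rX)).
rewrite big1 // => L _; rewrite !big1 ?addr0 ?scaler0 // => a _; rewrite big1 // => r _.
  by rewrite mxE rX ?(mulr0, oppr0) ?scale0r // par_Jh.
by rewrite rX ?scale0r // (negPf (par_Ih a)) andbF.
Qed.

Lemma str_anticomm X Y : homogeneous true X -> homogeneous true Y ->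
  str (X *m Y + Y *m X) = 0.
Proof.
move=> hX hY; rewrite /str.
under eq_bigr => i _ do rewrite mxE mulrDr.
rewrite big_split /=.
under eq_bigr => i _ do rewrite mxE mulr_sumr.
under [X in _ + X]eq_bigr => i _ do rewrite mxE mulr_sumr.
rewrite exchange_big /= -big_split /= big1 // => k _; rewrite -big_split /= big1 // => i _.
have [e|/hX ->] := eqVneq (par i (+) par k) true; last by rewrite !(mulr0, mul0r, addr0).
have -> : par i = ~~ par k by move: e; do 2!case: (par _).
by rewrite signrN mulNr (mulrC (Y k i)) addNr.
Qed.

Lemma homogeneous_anticomm X Y : homogeneous true X -> homogeneous true Y ->
  homogeneous false (X *m Y + Y *m X).
Proof.
move=> hX hY i j; rewrite negb_eqb addbF => e.
have mul0 A B : homogeneous true A -> homogeneous true B -> (A *m B) i j = 0.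
  move=> hA hB; rewrite mxE big1 // => k _.
  have [e'|/hA ->] := eqVneq (par i (+) par k) true; last by rewrite mul0r.
  by rewrite hB ?mulr0 //; move: e e'; do 3!case: (par _).
by rewrite mxE !mul0 ?addr0.
Qed.

Lemma mact_lowering X : (forall i j, ~~ (par i && ~~ par j) -> X i j = 0) ->
  Defs.mact true X w = 0.
Proof.
move=> lX.
have hX : homogeneous true X by move=> i j e; apply: lX; move: e; do 2!case: (par _).
have formula := mact_invelt (n * m) (s_row n) (s_col n) (t_row n m h) (t_col n m h)
  Jhn par_Ih hX.
apply: (raising_invariant_eq0 HF (row := s_row n)).
- move=> k; rewrite /s_row ltn_pmod //.
  have := leq_ltn_trans (leq0n k) (ltn_ord k).
  by rewrite -mulnDr muln_gt0 => /andP[].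
- move=> K s hs.
  (* Row symmetry is a linear condition, and it holds for each term because [ysym] applies the row
     symmetrizer last. *)
  pose P (u : mtens F n m (n * h + n * m) (n * m + h * m)) :=
    permact s (lslice K u) = lslice K u.
  have PS (A : finType) (f : A -> mtens F n m (n * h + n * m) (n * m + h * m)) :
      (forall i, P (f i)) -> P (\sum_i f i).
    move=> Pf; rewrite /P linear_sum (linear_sum (permact s)).
    by apply: eq_bigr => i _; apply: Pf.
  have PZ k u : P u -> P (k *: u) by rewrite /P !linearZ /= => ->.
  have PT x y : P (tprod (ysym (s_row n) (s_col n) x) y).
    by rewrite /P lslice_tprod linearZ /= ysymE permact_rsym.
  have PD u v : P u -> P v -> P (u + v) by rewrite /P !linearD /= => -> ->.
  rewrite -/(P _) formula; apply: (PS) => L; apply: (PZ); apply: (PD);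
    do 2!(apply: (PS) => ?); apply: (PZ); exact: PT.
(* At an all-even V-index, a term with an odd entry in its V-part vanishes; this covers those where
   [X] changes [Ih]. Where it changes [Jh], the new label is even, so an all-even [L] falls under
   [ysymt_even0]. *)
- move=> I K Iev; rewrite formula sum_ffunE big1 // => L _.
  rewrite fscale_ffunE fadd_ffunE !sum_ffunE !big1 ?addr0 ?mulr0 // => a _.
    rewrite sum_ffunE big1 // => r _; rewrite fscale_ffunE.
    have [pr|pr] := boolP (par r).
      by rewrite mxE lX ?pr ?andbF // ?(mulr0, oppr0, mul0r).
    have [/existsP[c Lc]|] := boolP [exists c, par (L c)].
      by rewrite [tprod _ _ _]ffunE /= (@ysym_all_even0 _ _ _ _ _ (rshift _ c)) ?catmiR // mul0r mulr0.
    rewrite negb_exists => /forallP Lev.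
    by rewrite ysymt_even0 // tprod0r [X in _ * X]ffunE mulr0.
  rewrite sum_ffunE big1 // => r _; rewrite fscale_ffunE.
  have [pr|pr] := boolP (par r); last by rewrite lX ?mul0r // (negPf pr).
  rewrite [tprod _ _ _]ffunE /= (@ysym_all_even0 _ _ _ _ _ (lshift _ a)) ?mul0r ?mulr0 //.
  by rewrite catmiL upd_at.
move=> Y rY; have hY := raising_homogeneous rY.
have := mact_anticomm w hX hY.
rewrite mact_raising // mact0 add0r => ->.
by rewrite mact_even ?str_anticomm ?mul0rn ?scale0r //; apply: homogeneous_anticomm.
Qed.

End Invariance.

Theorem theorem3p4 (F : fieldType) (n m h : nat) (HF : [pchar F] =i pred0) :
  sl_invariant
    (\sum_(L : mi n m (n * m))
        (-1) ^+ alpha L *: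
          tprod
            (ysym (s_row n) (s_col n) (basis F (catmi (Ih n m h) L)))
            (ysymt (t_row n m h) (t_col n m h) (basis F (catmi L (Jh n m h))))).
Proof.
move=> [] X hX sX; rewrite -/(invelt _ _ _ _ _ _ _ _); last first.
  by rewrite mact_even // sX mul0rn scale0r.
(* An odd [X] is split into its raising block [U] and its lowering block [D]. *)
pose U : 'M[F]_(n + m) := \matrix_(i, j) (if ~~ par i && par j then X i j else 0).
pose D : 'M[F]_(n + m) := \matrix_(i, j) (if par i && ~~ par j then X i j else 0).
have -> : X = U + D.
  apply/matrixP => i j; rewrite !mxE; have := hX i j.
  by case: (par i); case: (par j) => /= XE; rewrite ?addr0 ?add0r // XE.
rewrite mactDl mact_raising ?mact_lowering ?addr0 //.
  by move=> i j /negPf e; rewrite mxE e.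
by move=> i j /negPf e; rewrite mxE e.
Qed.
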